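(* (i) Let $\{N(t), t\ge 0\}$ be a Poisson process with rate $\lambda>0$, let $Y_1,Y_2,\ldots$ be independent copies of a random variable $Y$, independent of $\{N(t)\}$, with support $\{y_1,y_2,\ldots,y_m\}$, where $m\le\infty$ and the $y_i$ are positive integers, and let $X(t)=\sum_{i=1}^{N(t)}Y_i$ (an empty sum being $0$). Then for every $t>0$, $$\operatorname{supp}(X(t))=\{n_1y_1+n_2y_2+\cdots+n_my_m : n_1,\ldots,n_m\in Z_+\}$$ (when $m=\infty$, only finitely many of the $n_i$ are nonzero), i.e. the support of $X(t)$ is the additive semigroup (containing $0$) generated by the $y_i$'s. (ii) Let $X$ be an infinitely divisible $Z_+$-valued random variable with distribution function $F$, such that $\operatorname{supp}(X-\ell_X)$ has greatest common divisor $1$, where $\ell_X$ is the left extremity of $X$. For $n\in N$ let $F_n$ denote the $n$th convolution root of $F$. Let $n\in N$ with $n\ge 2$ be given. Then $\operatorname{supp}(F_n)=\operatorname{supp}(F)$ if and only if $X$ is discretely infinitely divisible, and in that case $\operatorname{supp}(F_n)=\operatorname{supp}(F)$ holds for all $n\in N$.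
   Context: $N$ is the set of positive integers and $Z_+$ the set of nonnegative integers. $\operatorname{supp}(X)$ or $\operatorname{supp}(F)$ denotes the support of a random variable $X$ or of its distribution function $F$. A $Z_+$-valued random variable $X$ is infinitely divisible (ID) if for every $n\in N$ there exists a (real-valued) random variable $X_n$ such that $X$ has the same distribution as $X_{n,1}+\cdots+X_{n,n}$, where the $X_{n,i}$ are independent copies of $X_n$. It is discretely infinitely divisible (DID) if for every $n\in N$ such an $X_n$ exists which is $Z_+$-valued. The $n$th convolution root $F_n$ of $F$ is the distribution function of $X_n$. The left extremity of $X$ is $\ell_X=\min\{j\in Z_+: P\{X=j\}>0\}$. *)

(* Defs.v *)
From HB Require Import structures.
From mathcomp Require Import all_boot all_order all_algebra.
From mathcomp Require Import all_classical all_reals all_analysis.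
From mathcomp Require Import measurable_realfun.
Set Implicit Arguments.
Unset Strict Implicit.
Unset Printing Implicit Defensive.
Import Order.TTheory GRing.Theory Num.Theory.
Import numFieldNormedType.Exports.
Local Open Scope classical_set_scope.
Local Open Scope ring_scope.

(** The support of a distribution function is its set of points of increase;
    the support of a random variable [X] is [supp (cdf X)]. *)
Definition supp (R : realType) (F : R -> \bar R) : set R :=
  [set x : R | forall e : R, 0 < e -> (F (x - e)%R < F (x + e)%R)%E].

Definition same_law (R : realType) d1 (T1 : measurableType d1)
    (P1 : probability T1 R) d2 (T2 : measurableType d2)
    (P2 : probability T2 R) (X : {RV P1 >-> R}) (Y : {RV P2 >-> R}) : Prop :=
  forall A : set R, measurable A -> distribution P1 X A = distribution P2 Y A.

Section independence.
Context (R : realType) d (T : measurableType d) (P : probability T R).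

Definition mutually_independent d' (U : measurableType d') (I : eqType)
    (X : I -> T -> U) : Prop :=
  forall (s : seq I) (A : I -> set U), uniq s ->
    (forall i, measurable (A i)) ->
    P (\bigcap_(i in [set` s]) X i @^-1` A i) =
    (\prod_(i <- s) P (X i @^-1` A i))%E.

Definition sigma_of_family d' (U : measurableType d') (I : Type) (D : set I)
    (X : I -> T -> U) : set (set T) :=
  <<s \bigcup_(i in D) preimage_set_system [set: T] (X i) measurable >>.

Definition independent_systems (G H : set (set T)) : Prop :=
  forall A B, G A -> H B -> P (A `&` B) = (P A * P B)%E.

End independence.

Section sums.
Context (R : realType) d (T : measurableType d) (P : probability T R).

Definition fixed_sum n (X : 'I_n -> {RV P >-> R}) : T -> R :=
  fun w => \sum_(i < n) X i w.

Let measurable_fixed_sum n (X : 'I_n -> {RV P >-> R}) :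
  measurable_fun [set: T] (fixed_sum X).
Proof. by apply: measurable_sum => i. Qed.

HB.instance Definition _ n (X : 'I_n -> {RV P >-> R}) :=
  isMeasurableFun.Build _ _ _ _ (fixed_sum X) (measurable_fixed_sum X).

(** Indices are shifted by one: [Y i] is the summand usually written
    $Y_{i+1}$. *)
Definition random_sum (N : {RV P >-> nat}) (Y : nat -> {RV P >-> R}) : T -> R :=
  fun w => \sum_(i < N w) Y i w.

Let measurable_random_sum (N : {RV P >-> nat}) (Y : nat -> {RV P >-> R}) :
  measurable_fun [set: T] (random_sum N Y).
Proof.
move=> _ B mB; rewrite setTI.
have -> : random_sum N Y @^-1` B =
    \bigcup_k (N @^-1` [set k] `&` fixed_sum (fun i : 'I_k => Y i) @^-1` B).
  apply/seteqP; split=> [w Bw|w [k _ [/= <-]]] //.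
  by exists (N w).
apply: bigcupT_measurable => k; apply: measurableI.
- by rewrite -[X in measurable X]setTI; exact: measurable_funPT.
- by rewrite -[X in measurable X]setTI; exact: measurable_fixed_sum.
Qed.

HB.instance Definition _ (N : {RV P >-> nat}) (Y : nat -> {RV P >-> R}) :=
  isMeasurableFun.Build _ _ _ _ (random_sum N Y) (measurable_random_sum N Y).

Definition translate (X : {RV P >-> R}) (c : R) : T -> R := fun w => X w - c.

Let measurable_translate X c : measurable_fun [set: T] (translate X c).
Proof. by apply: measurable_funD. Qed.

HB.instance Definition _ X c :=
  isMeasurableFun.Build _ _ _ _ (translate X c) (@measurable_translate X c).

End sums.

Section poisson_process.
Context (R : realType) d (T : measurableType d) (P : probability T R).

(** Only the times [t >= 0] are constrained; the values of [N] at negative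
    times are irrelevant. *)
Definition is_poisson_process (lambda : R) (N : R -> {RV P >-> nat}) : Prop :=
  [/\ \forall w \ae P,
        [/\ N 0 w = 0%N,
            forall s t : R, 0 <= s -> s <= t -> (N s w <= N t w)%N
          & forall t : R, 0 <= t ->
              ((N u w)%:R : R) @[u --> t^'+] --> ((N t w)%:R : R)],
      forall t : nat -> R, 0 <= t 0%N ->
        (forall i, t i <= t i.+1) ->
        mutually_independent P
          (fun (i : nat) (w : T) => (N (t i.+1) w)%:R - (N (t i) w)%:R : R)
    & forall (s t : R) (k : nat), 0 <= s -> s < t ->
        P [set w | (N t w)%:R - (N s w)%:R = k%:R :> R] =
        (poisson_pmf (lambda * (t - s)) k)%:E].

End poisson_process.

(** The index set $\{1,\ldots,m\}$ with $m\le\infty$, shifted to start at [0];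
    [None] stands for $m=\infty$. *)
Definition index_set (m : option nat) : set nat :=
  if m is Some k then `I_k else [set: nat].

Definition nonneg_combinations (R : realType) (m : option nat)
    (y : nat -> nat) : set R :=
  [set x : R | exists2 n : nat -> nat,
     finite_set (index_set m `&` [set i | n i != 0%N])
     & x = \sum_(i \in index_set m) ((n i * y i)%:R : R)].

Definition generated_semigroup0 (R : realType) (G : set R) : set R :=
  smallest
    [set S : set R | S 0 /\ forall a b, S a -> S b -> S (a + b)] G.

Section divisibility.
Context (R : realType).

Section one_variable.
Context d (T : measurableType d) (P : probability T R) (X : {RV P >-> R}).

Definition Zplus_valued : Prop := \forall w \ae P, exists k : nat, X w = k%:R.

Definition is_left_extremity (l : nat) : Prop :=
  (0 < P (X @^-1` [set l%:R]))%E /\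
  forall j : nat, (0 < P (X @^-1` [set j%:R]))%E -> (l <= j)%N.

(** [Xn] is a root of [X]; neither it nor its independent copies [Y] need to
    live on the probability space of [X]. *)
Definition is_nth_root (n : nat) d' (T' : measurableType d')
    (P' : probability T' R) (Xn : {RV P' >-> R}) : Prop :=
  exists d'' (T'' : measurableType d'') (P'' : probability T'' R)
    (Y : 'I_n -> {RV P'' >-> R}),
    [/\ mutually_independent P'' (fun i => Y i : T'' -> R),
        forall i, same_law (Y i) Xn
      & same_law X (fixed_sum Y : {RV P'' >-> R})].

Definition infinitely_divisible : Prop :=
  forall n, (0 < n)%N ->
    exists d' (T' : measurableType d') (P' : probability T' R)
      (Xn : {RV P' >-> R}), is_nth_root n Xn.

End one_variable.

Definition discretely_infinitely_divisible d (T : measurableType d)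
    (P : probability T R) (X : {RV P >-> R}) : Prop :=
  forall n, (0 < n)%N ->
    exists d' (T' : measurableType d') (P' : probability T' R)
      (Xn : {RV P' >-> R}), is_nth_root X n Xn /\ Zplus_valued Xn.

Definition is_convolution_root d (T : measurableType d)
    (P : probability T R) (X : {RV P >-> R}) (n : nat) (Fn : R -> \bar R) :
    Prop :=
  exists d' (T' : measurableType d') (P' : probability T' R)
    (Xn : {RV P' >-> R}), is_nth_root X n Xn /\ Fn = cdf Xn.

Definition has_gcd (A : set R) (g : nat) : Prop :=
  (forall k : nat, A k%:R -> (g %| k)%N) /\
  (forall e : nat, (forall k : nat, A k%:R -> (e %| k)%N) -> (e %| g)%N).

End divisibility.

(* Main.v *)
(* A random variable lies almost surely in its support, and supports add under
   independent sums.

   (i) Almost surely every [Y_i] lies in [{y_1, y_2, ...}], so [X(t)] lies in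
   the semigroup they generate. Conversely, a combination written as a sum of
   [k] generators is attained with positive probability on the event that
   [N(t) = k] and each of the first [k] jumps takes the prescribed value.

   (ii) If [Y] is an [n]-th root of [X], additivity of supports forces
   [supp Y] to contain [l_X / n] and to be included in [l_X / n + Z_+]. Hence
   [X] is DID iff [l_X = 0], and equality of the supports for some [n >= 2]
   forces [l_X / n >= l_X], i.e. [l_X = 0]. When [l_X = 0], a value [j] of [X]
   is a sum of at most [j] nonzero values of the root of order [(j + 1) k];
   by uniqueness of [k]-th roots of power series with positive constant
   coefficient, summing [j + 1] copies of the latter gives the root of order
   [k], which therefore has [j] in its support. *)
Require Import Defs.
From HB Require Import structures.
From mathcomp Require Import all_boot all_order all_algebra.
From mathcomp Require Import all_classical all_reals all_analysis.
From mathcomp Require Import ring lra.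
Import Order.TTheory GRing.Theory Num.Theory.
Import numFieldNormedType.Exports.
Local Open Scope classical_set_scope.
Local Open Scope ring_scope.
Set Implicit Arguments.
Unset Strict Implicit.

(** * Powers of polynomials, seen as truncated power series *)

Lemma dvdXnP (F : fieldType) (p : {poly F}) m :
  reflect (forall i, (i < m)%N -> p`_i = 0) ('X^m %| p).
Proof.
apply: (iffP idP) => [/dvdpP[q ->] i im|p0]; first by rewrite coefMXn im.
rewrite -[p](poly_take_drop m) [take_poly m p](_ : _ = 0) ?add0r ?dvdp_mull//.
by apply/polyP => i; rewrite coef_take_poly coef0; case: ifP => // /p0.
Qed.

(** For positive [m] the constant coefficients agree, being nonnegative with equal [n]-th powers.
    The cofactor of [f - g] in [f ^+ n - g ^+ n] then takes at 0 the value n c^(n-1), with c > 0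
    this common coefficient, so it is coprime to ['X^m]. *)
Lemma eq_root_mod_Xn (F : realFieldType) (f g : {poly F}) n m :
  (0 < n)%N -> 0 <= f`_0 -> 0 < g`_0 ->
  'X^m %| f ^+ n - g ^+ n -> 'X^m %| f - g.
Proof.
case: m => [|m] n0 f0 g0; first by rewrite expr0 !dvd1p.
move=> fgn.
have fg : f`_0 = g`_0.
  have /dvdXnP/(_ 0%N erefl)/eqP := fgn.
  rewrite -horner_coef0 !hornerE !horner_coef0 subr_eq0.
  by rewrite eqrXn2// ?ltW// => /eqP.
move: fgn; rewrite subrXX Gauss_dvdpl// coprimep_expl// coprimep_sym coprimepX.
rewrite /root horner_sum (eq_bigr (fun=> g`_0 ^+ n.-1)).
  by rewrite sumr_const card_ord mulrn_eq0 negb_or -lt0n n0 expf_neq0// gt_eqF.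
move=> i _; rewrite !hornerE !horner_coef0 fg -exprD.
by rewrite subnK// -ltnS prednK.
Qed.

Lemma coefX_ge0 (F : realFieldType) (p : {poly F}) n :
  (forall i, 0 <= p`_i) -> forall i, 0 <= (p ^+ n)`_i.
Proof.
move=> p0; elim: n => [|n IH] i; first by rewrite expr0 coef1 ler0n.
by rewrite exprS coefM sumr_ge0// => j _; rewrite mulr_ge0.
Qed.

(* Writing [r = r`_0 + u] with ['X %| u], only the powers [u ^+ i] with
   [i <= j] contribute to the coefficient of ['X^j]. *)
Lemma coefX_gt0 (F : realFieldType) (r : {poly F}) n m j :
  (forall i, 0 <= r`_i) -> 0 < r`_0 -> (j <= m)%N ->
  0 < (r ^+ n)`_j -> 0 < (r ^+ m)`_j.
Proof.
move=> r0 r00 jm.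
pose u := r - (r`_0)%:P.
have u0 i : 0 <= u`_i.
  by rewrite coefB coefC; case: i => [|i]; rewrite ?subrr ?subr0.
have uX i : (j < i)%N -> (u ^+ i)`_j = 0.
  move=> ji; have /dvdXnP -> // : 'X^i %| u ^+ i.
  by rewrite dvdp_exp2r// -['X]subr0 -polyC0 dvdp_XsubCl /root horner_coef0
    coefB coefC subrr.
have E k : (r ^+ k)`_j =
    \sum_(i < k.+1) (r`_0 ^+ (k - i) * (u ^+ i)`_j) *+ 'C(k, i).
  rewrite -{1}[r](subrKC (r`_0)%:P) -/u exprDn coef_sum.
  by apply: eq_bigr => i _; rewrite coefMn -polyC_exp coefCM.
have T0 k i : 0 <= (r`_0 ^+ (k - i) * (u ^+ i)`_j) *+ 'C(k, i).
  by rewrite mulrn_wge0// mulr_ge0 ?exprn_ge0 ?coefX_ge0.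
have [[i ij ui] _|nou] : {i | (i <= j)%N & 0 < (u ^+ i)`_j} +
    (forall i, (u ^+ i)`_j = 0).
- case: (pickP (fun i : 'I_j.+1 => 0 < (u ^+ i)`_j)) => [i ui|no].
    by left; exists i => //; rewrite -ltnS.
  right => i; case: (ltnP j i) => [/uX//|ij].
  apply/eqP; rewrite eq_le coefX_ge0// andbT leNgt.
  by have /= -> := no (Ordinal (ij : (i < j.+1)%N)).
- have im : (i < m.+1)%N by rewrite ltnS (leq_trans ij).
  rewrite E (bigD1 (Ordinal im))//= ltr_pwDl ?sumr_ge0//.
  by rewrite pmulrn_rgt0 ?bin_gt0// mulr_gt0 ?exprn_gt0.
- by rewrite E big1 ?ltxx// => i _; rewrite nou mulr0 mul0rn.
Qed.

(** Links convolution with powers of polynomials: for a mass function [q], the right-hand side is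
    the probability that [n] independent variables, all below [m], add up to [j]. *)
Lemma coef_polyX (F : comNzRingType) (q : nat -> F) n m j :
  ((\poly_(k < m) q k) ^+ n)`_j =
  \sum_(f : {ffun 'I_n -> 'I_m} | (\sum_i f i)%N == j) \prod_i q (f i).
Proof.
rewrite poly_def -[in LHS](card_ord n) -prodr_const bigA_distr_bigA/= coef_sum.
rewrite [RHS]big_mkcond/=; apply: eq_bigr => f _.
rewrite scaler_prod prodrXr coefZ coefXn eq_sym.
by case: eqP => _; rewrite ?mulr1 ?mulr0.
Qed.

(** * Comparing events up to null sets *)

Section almost_everywhere.
Context d (T : measurableType d) (R : realType) (P : probability T R).

Lemma ae_le_measure (A B : set T) : measurable A -> measurable B ->
  (\forall w \ae P, A w -> B w) -> (P A <= P B)%E.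
Proof.
move=> mA mB AB.
have AB0 : P (A `\` B) = 0%E.
  apply/negligibleP; first exact: measurableD.
  by apply: negligibleS AB => w [Aw Bw] /(_ Aw).
rewrite (measureDI P mA mB) -[leRHS]add0e -AB0 leeD2l// le_measure// inE//.
exact: measurableI.
Qed.

Lemma ae_measure_eq (A B : set T) : measurable A -> measurable B ->
  (\forall w \ae P, A w <-> B w) -> P A = P B.
Proof.
move=> mA mB AB; apply/eqP; rewrite eq_le; apply/andP.
by split; apply: ae_le_measure => //; apply: filterS AB => w [].
Qed.

(** Lets later arguments fix one sample point at which an event of positive probability and an
    almost sure property hold together. *)
Lemma measure_gt0_ae_ex (A : set T) (Q : T -> Prop) : measurable A ->
  (0 < P A)%E -> (\forall w \ae P, Q w) -> exists2 w, A w & Q w.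
Proof.
move=> mA A0 aeQ; apply: contrapT => /forall2NP AQ.
suff : (P A <= P set0)%E by rewrite measure0 leNgt A0.
apply: ae_le_measure => //; apply: filterS aeQ => w Qw Aw.
by case: (AQ w).
Qed.

End almost_everywhere.

(** * Supports, atoms and integer-valued variables *)

Section support.
Context d (T : measurableType d) (R : realType) (P : probability T R).
Implicit Type X : {RV P >-> R}.

Lemma cdfD X (a b : R) : a <= b ->
  (cdf X b = cdf X a + P (X @^-1` `]a, b]))%E.
Proof.
move=> ab; rewrite /cdf /distribution /pushforward/=.
rewrite (_ : `]-oo, b] = `]-oo, a] `|` `]a, b])%classic; last first.
  by rewrite -itv_bndbnd_setU.
rewrite preimage_setU measureU//; try exact: measurable_funPTI.
apply/seteqP; split => w //= []; rewrite !in_itv/= => wa /andP[aw _].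
by move: (lt_le_trans aw wa); rewrite ltxx.
Qed.

Lemma supp_cdfP X (x : R) : supp (cdf X) x <->
  forall e : R, 0 < e -> (0 < P (X @^-1` `](x - e)%R, (x + e)%R]))%E.
Proof.
have E (e : R) : 0 < e -> (cdf X (x - e)%R < cdf X (x + e)%R)%E =
    (0 < P (X @^-1` `](x - e)%R, (x + e)%R]))%E.
  move=> e0; rewrite [cdf X (x + e)](@cdfD X (x - e)); last by lra.
  by rewrite lteDl// fin_num_measure//; exact: measurable_funPTI.
by split => H e e0; move: (H e e0); rewrite E.
Qed.

Lemma supp_atom X (x : R) : (0 < P (X @^-1` [set x]))%E -> supp (cdf X) x.
Proof.
move=> X0; apply/supp_cdfP => e e0; apply: (lt_le_trans X0).
apply: le_measure; rewrite ?inE//; try exact: measurable_funPTI.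
by move=> w /= ->; rewrite in_itv/=; apply/andP; split; lra.
Qed.

(* A point outside the support lies in a null interval with rational
   endpoints, and there are countably many of those. *)
Lemma ae_supp X : \forall w \ae P, supp (cdf X) (X w).
Proof.
pose I (p : rat * rat) : set R := `]ratr p.1, ratr p.2]%classic.
have mI p : measurable (I p) by rewrite /I.
(* Enumerating the rational pairs by [unpickle] reduces the claim to countably many almost sure
   statements. *)
have : \forall w \ae P, forall k p, unpickle k = Some p ->
    P (X @^-1` I p) = 0%E -> ~ I p (X w).
  apply/ae_foralln => k; case E : (unpickle k) => [p|]; last exact: aeW.
  have [X0|X0] := eqVneq (P (X @^-1` I p)) 0%E; last first.
    by apply: aeW => w _ [<-] Xp; rewrite Xp eqxx in X0.
  have : P.-negligible (X @^-1` I p).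
    by apply/negligibleP; [exact: (measurable_funPTI _ (mI p))|].
  by apply: negligibleS => w /= nI; apply: contrapT => nIw; apply: nI => _ [<-].
apply: filterS => w Xw; apply/supp_cdfP => e e0.
have [|a /itvP ha] := @rat_in_itvoo R (X w - e) (X w); first by lra.
have [|b /itvP hb] := @rat_in_itvoo R (X w) (X w + e); first by lra.
have Xab : (0 < P (X @^-1` I (a, b)))%E.
  rewrite measure_gt0; apply/eqP => X0.
  apply: (Xw _ _ (pickleK (a, b)) X0) => //=.
  by rewrite /I/= in_itv/= ha ltW ?hb.
apply: (lt_le_trans Xab); apply: le_measure; rewrite ?inE//; try exact: measurable_funPTI.
move=> v /=; rewrite /I/= !in_itv/= => /andP[av vb].
by rewrite (lt_trans _ av) ?ha// (le_trans vb)// ltW// hb.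
Qed.

Lemma eq_natr_dist (j k : nat) : j%:R - 1 < k%:R :> R -> k%:R < j%:R + 1 :> R ->
  j = k.
Proof.
rewrite ltrBlDr !natr1 !ltr_nat => jk kj.
by apply/eqP; rewrite eqn_leq -ltnS jk -ltnS.
Qed.

(** Every neighbourhood of a support point contains a nonnegative integer; integers being isolated,
    the point is itself one and carries the mass found around it. *)
Lemma supp_Zplus X : Zplus_valued X -> forall x, supp (cdf X) x ->
  exists2 k : nat, x = k%:R & (0 < P (X @^-1` [set k%:R]))%E.
Proof.
move=> XN x /supp_cdfP sx.
have near (e : R) : 0 < e -> exists k : nat, x - e < k%:R <= x + e.
  move=> e0; have [|w /= Xw [k Xk]] := measure_gt0_ae_ex _ (sx e e0) XN.
    exact: measurable_funPTI.
  by exists k; rewrite -Xk; move: Xw; rewrite in_itv.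
have [|k /andP[k1 k2]] := near 4^-1; first by rewrite invr_gt0.
have xk : x = k%:R.
  apply: contrapT => /eqP xk.
  (* An integer within half the distance from [x] to [k] must be [k] itself, which is absurd if that
     distance is positive. *)
  have [|j /andP[j1 j2]] := near (`|x - k%:R| / 2).
    by rewrite divr_gt0// normr_gt0 subr_eq0.
  have h : `|x - k%:R| <= 4^-1.
    rewrite ler_norml; apply/andP; clear -k1 k2; split; lra.
  have jk : j = k by apply: eq_natr_dist; clear -k1 k2 j1 j2 h; lra.
  rewrite jk in j1 j2.
  have : `|x - k%:R| <= `|x - k%:R| / 2.
    by rewrite ler_norml; apply/andP; clear -j1 j2; split; lra.
  have : 0 < `|x - k%:R| by rewrite normr_gt0 subr_eq0.
  by clear; lra.
(* With radius 1/2, [k] is the only integer in the interval. *)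
exists k => //; have := sx 2^-1; rewrite xk invr_gt0 ltr0n => /(_ isT)/lt_le_trans; apply.
apply: ae_le_measure; try exact: measurable_funPTI.
apply: filterS XN => w [j Xj] /=; rewrite in_itv/= Xj => /andP[j1 j2].
by congr (_%:R); apply: eq_natr_dist; clear -j1 j2; lra.
Qed.

Lemma Zplus_supp X : (forall x, supp (cdf X) x -> exists k : nat, x = k%:R) ->
  Zplus_valued X.
Proof. by move=> XN; apply: filterS (ae_supp X) => w /XN. Qed.

End support.

(** * Finite independent sums: supports and mass functions *)

Section independent_sums.
Context d (T : measurableType d) (R : realType) (P : probability T R).

Lemma independent_gt0 (I : eqType) (X : I -> T -> R) (s : seq I)
    (A : I -> set R) :
  mutually_independent P X -> uniq s -> (forall i, measurable (A i)) ->
  (forall i, i \in s -> (0 < P (X i @^-1` A i))%E) ->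
  (0 < P (\bigcap_(i in [set` s]) X i @^-1` A i))%E.
Proof.
move=> indX us mA X0; rewrite indX// big_seq.
by apply: (big_ind (fun x => 0 < x)%E) => //; exact: mule_gt0.
Qed.

Variables (n : nat) (Y : 'I_n -> {RV P >-> R}).
Hypothesis indY : mutually_independent P (fun i => Y i : T -> R).

Lemma supp_fixed_sum (x : 'I_n -> R) : (forall i, supp (cdf (Y i)) (x i)) ->
  supp (cdf (fixed_sum Y : {RV P >-> R})) (\sum_i x i).
Proof.
move=> sx; apply/supp_cdfP => e e0.
(* Dividing by [n.+1] keeps the total error [n%:R * r] strictly below [e], also when [n = 0]. *)
pose r := e / n.+1%:R.
have r0 : 0 < r by rewrite divr_gt0.
pose A i : set R := `](x i - r)%R, (x i + r)%R]%classic.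
have mA i : measurable (A i) by rewrite /A.
have /lt_le_trans : (0 < P (\bigcap_(i in [set` index_enum 'I_n]) Y i @^-1` A i))%E.
  apply: (independent_gt0 indY) => // [|i _]; first exact: index_enum_uniq.
  by move/supp_cdfP : (sx i); exact.
apply; apply: le_measure; rewrite ?inE//.
- by apply: fin_bigcap_measurable => // i _; exact: (measurable_funPTI _ (mA i)).
- exact: measurable_funPTI.
move=> w /= Aw; have {}Aw i : x i - r < Y i w <= x i + r.
  by have := Aw i (mem_index_enum i); rewrite /A /= in_itv.
have nr : n%:R * r < e.
  by rewrite /r mulrA ltr_pdivrMr// mulrC ltr_pM2l// ltr_nat.
have nrE : \sum_(i < n) r = n%:R * r by rewrite sumr_const card_ord mulr_natl.
rewrite in_itv/= /fixed_sum; apply/andP; split.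
- apply: (@lt_le_trans _ _ (\sum_i (x i - r))); last first.
    by apply: ler_sum => i _; apply/ltW; case/andP: (Aw i).
  by rewrite sumrB nrE ltrD2l ltrN2.
- apply: (@le_trans _ _ (\sum_i (x i + r))).
    by apply: ler_sum => i _; case/andP: (Aw i).
  by rewrite big_split/= nrE lerD2l ltW.
Qed.

(** Up to a null set the event splits into the disjoint events [E f], one per tuple of values with
    total [j]. Truncation at [m] loses nothing, since nonnegative integers with sum [j < m] are all
    below [m]. *)
Lemma pmf_fixed_sum (q : nat -> R) (m j : nat) : (j < m)%N ->
  (forall i k, P (Y i @^-1` [set k%:R]) = (q k)%:E) ->
  (\forall w \ae P, forall i, exists k : nat, Y i w = k%:R) ->
  P (fixed_sum Y @^-1` [set j%:R]) = (((\poly_(k < m) q k) ^+ n)`_j)%:E.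
Proof.
move=> jm Yq YN.
pose E (f : {ffun 'I_n -> 'I_m}) :=
  \bigcap_(i in [set` index_enum 'I_n]) Y i @^-1` [set (f i)%:R].
have mE f : measurable (E f).
  by apply: fin_bigcap_measurable => // i _; exact: measurable_funPTI.
pose r := [seq f : {ffun 'I_n -> 'I_m} <- index_enum _ | (\sum_i f i)%N == j].
have PE f : P (E f) = (\prod_i q (f i))%:E.
  rewrite indY//; last exact: index_enum_uniq.
  by rewrite -prodEFin; apply: eq_bigr => i _; rewrite Yq.
rewrite coef_polyX -sumEFin -big_filter -/r.
rewrite (eq_bigr (fun f => P (E f))) => [|f _]; last by rewrite PE.
rewrite fsbig_seq; last by rewrite filter_uniq// index_enum_uniq.
rewrite -measure_fin_bigcup//; last first.
  move=> f g _ _ [w [fw gw]]; apply/ffunP => i; apply/val_inj/eqP.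
  rewrite -(eqr_nat R); apply/eqP.
  have /= <- := fw i (mem_index_enum i).
  by have /= <- := gw i (mem_index_enum i).
apply: ae_measure_eq.
- exact: measurable_funPTI.
- by apply: fin_bigcup_measurable.
apply: filterS YN => w /choice[v Yv]; rewrite /= /fixed_sum; split.
- rewrite (eq_bigr (fun i => (v i)%:R)) => [|i _]; last exact: Yv.
  rewrite -natr_sum => /eqP; rewrite eqr_nat => /eqP vj.
  have vi i : (v i < m)%N.
    by apply: leq_ltn_trans jm; rewrite -vj (bigD1 i)//= leq_addr.
  exists [ffun i => Ordinal (vi i)] => /=.
    rewrite mem_filter mem_index_enum andbT; apply/eqP.
    by rewrite -vj; apply: eq_bigr => i _; rewrite ffunE.
  by move=> i _ /=; rewrite ffunE Yv.
- move=> [f /=]; rewrite mem_filter => /andP[/eqP fj _] fw.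
  rewrite -fj natr_sum; apply: eq_bigr => i _.
  exact: (fw i (mem_index_enum i)).
Qed.

End independent_sums.

Lemma same_law_cdf (R : realType) d1 (T1 : measurableType d1)
    (P1 : probability T1 R) d2 (T2 : measurableType d2)
    (P2 : probability T2 R) (X : {RV P1 >-> R}) (Y : {RV P2 >-> R}) :
  same_law X Y -> cdf X = cdf Y.
Proof. by move=> XY; apply/funext => r; exact: XY. Qed.

(** * Convolution roots of an integer-valued variable *)

Section roots.
Context d (T : measurableType d) (R : realType) (P : probability T R).
Variable X : {RV P >-> R}.
Hypothesis XN : Zplus_valued X.

Lemma supp_left_extremity l v : is_left_extremity X l -> supp (cdf X) v ->
  exists2 k : nat, v = k%:R & (l <= k)%N.
Proof. by move=> [_ lmin] /(supp_Zplus XN)[k -> /lmin lk]; exists k. Qed.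

Lemma nth_root_supp l n d' (T' : measurableType d') (P' : probability T' R)
    (Xn : {RV P' >-> R}) :
  is_left_extremity X l -> (0 < n)%N -> is_nth_root X n Xn ->
  supp (cdf Xn) (l%:R / n%:R) /\
  forall x, supp (cdf Xn) x ->
    exists2 k : nat, x = l%:R / n%:R + k%:R & supp (cdf X) (l + k)%:R.
Proof.
move=> lX n0 [d'' [T'' [P'' [Y [indY YXn XY]]]]].
have nR0 : 0 < n%:R :> R by rewrite ltr0n.
have suppY i : supp (cdf (Y i)) = supp (cdf Xn).
  by rewrite (same_law_cdf (YXn i)).
have sumX (x : 'I_n -> R) : (forall i, supp (cdf Xn) (x i)) ->
    supp (cdf X) (\sum_i x i).
  move=> sx; rewrite (same_law_cdf XY); apply: supp_fixed_sum => // i.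
  by rewrite suppY.
have Xn_ge x : supp (cdf Xn) x -> l%:R / n%:R <= x.
  move=> sx; have /(supp_left_extremity lX)[k] := sumX (fun=> x) (fun=> sx).
  rewrite sumr_const card_ord -[x *+ n]mulr_natl => xk lk.
  by rewrite ler_pdivrMr// mulrC xk ler_nat.
(* When the sum equals [l], the nonnegative terms [Y i w - l%:R / n%:R] add up to 0, so each copy
   equals [l%:R / n%:R]. *)
have sl : supp (cdf Xn) (l%:R / n%:R).
  have : (0 < P'' (fixed_sum Y @^-1` [set l%:R]))%E.
    by case: lX => + _; rewrite [P _](XY [set l%:R]).
  move/(measure_gt0_ae_ex (measurable_funPTI _ (measurable_set1 _))).
  have aeY : \forall w \ae P'', forall i, supp (cdf (Y i)) (Y i w).
    by apply: filter_forall => i; exact: ae_supp.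
  move=> /(_ _ aeY)[w /= wl sw].
  have {}sw i : supp (cdf Xn) (Y i w) by rewrite -(suppY i).
  rewrite (_ : _ / _ = Y (Ordinal n0) w)//; apply/esym/eqP.
  rewrite -subr_eq0; apply/eqP.
  apply: (psumr_eq0P (P := xpredT) (F := fun i => Y i w - l%:R / n%:R)) => // [i _|].
    by rewrite subr_ge0 Xn_ge.
  rewrite sumrB [X in X - _]wl sumr_const card_ord -[_ *+ n]mulr_natl mulrC divfK ?subrr//.
  by rewrite gt_eqF.
(* Taking [x] for one copy and [l%:R / n%:R] for the others yields a support point of [X] equal to l
   + (x - l/n). *)
split => // x sx; pose i0 := Ordinal n0.
have /(sumX (fun i => if i == i0 then x else l%:R / n%:R)) :
    forall i, supp (cdf Xn) (if i == i0 then x else l%:R / n%:R).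
  by move=> i; case: eqP.
rewrite (bigD1 i0)//= (eq_bigr (fun=> l%:R / n%:R)); last first.
  by move=> i /negPf ->.
have : l%:R = \sum_(i < n) (l%:R / n%:R) :> R.
  by rewrite sumr_const card_ord -[_ *+ n]mulr_natl mulrC divfK// gt_eqF.
rewrite (bigD1 i0)//=; set S := (X in _ + X) => lS sX.
have [k xk lk] := supp_left_extremity lX sX.
exists (k - l)%N; last by rewrite subnKC// -xk.
by rewrite natrB// -xk [X in _ - X]lS -/S; clearbody S; ring.
Qed.

(** The support of a root of order [l.+1] contains [l%:R / l.+1%:R], an integer only for [l = 0].
    Conversely, [l = 0] puts the support of every root among the nonnegative integers. *)
Lemma DID_left_extremity l : infinitely_divisible X -> is_left_extremity X l ->
  discretely_infinitely_divisible X <-> l = 0%N.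
Proof.
move=> idX lX; split => [didX|l0 n n0].
- have [d' [T' [P' [Xn [rX XnN]]]]] := didX l.+1 isT.
  have [/(supp_Zplus XnN)[k lk _] _] := nth_root_supp lX (ltn0Sn l) rX.
  have : l%:R = (k * l.+1)%:R :> R by rewrite natrM -lk divfK// pnatr_eq0.
  move/eqP; rewrite eqr_nat => /eqP; case: k {lk} => // k lk.
  have : (l.+1 <= l)%N by rewrite {2}lk leq_pmull.
  by rewrite ltnn.
- have [d' [T' [P' [Xn rX]]]] := idX n n0.
  exists d', T', P', Xn; split => //; apply: Zplus_supp => x.
  rewrite l0 in lX; have [_ /[apply]] := nth_root_supp lX n0 rX.
  by rewrite mul0r => -[k -> _]; exists k; rewrite add0r.
Qed.

Lemma pmf_nth_root n d' (T' : measurableType d') (P' : probability T' R)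
    (Xn : {RV P' >-> R}) m j :
  Zplus_valued Xn -> is_nth_root X n Xn -> (j < m)%N ->
  P (X @^-1` [set j%:R]) =
  (((\poly_(k < m) fine (P' (Xn @^-1` [set k%:R]))) ^+ n)`_j)%:E.
Proof.
move=> XnN [d'' [T'' [P'' [Y [indY YXn XY]]]]] jm.
rewrite [LHS](XY [set j%:R])//; apply: pmf_fixed_sum => // [i k|].
  rewrite fineK; last by rewrite fin_num_measure//; exact: measurable_funPTI.
  exact: (YXn i).
apply: filter_forall => i; apply: Zplus_supp => x.
by rewrite (same_law_cdf (YXn i)) => /(supp_Zplus XnN)[k]; exists k.
Qed.

Lemma supp_nth_root k d' (T' : measurableType d') (P' : probability T' R)
    (Xk : {RV P' >-> R}) :
  infinitely_divisible X -> is_left_extremity X 0 -> (0 < k)%N ->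
  is_nth_root X k Xk -> supp (cdf Xk) = supp (cdf X).
Proof.
move=> idX X0 k0 rk.
have root0 n d1 (T1 : measurableType d1) (P1 : probability T1 R)
    (Z : {RV P1 >-> R}) : (0 < n)%N -> is_nth_root X n Z ->
    [/\ Zplus_valued Z, (0 < P1 (Z @^-1` [set 0%N%:R]))%E &
      supp (cdf Z) `<=` supp (cdf X)].
  move=> n0 rZ; have := nth_root_supp X0 n0 rZ; rewrite mul0r => -[Z0 sZ].
  have ZN : Zplus_valued Z.
    by apply: Zplus_supp => x /sZ[j -> _]; exists j; rewrite add0r.
  split => //; last by move=> x /sZ[j ->]; rewrite add0r.
  have [j] := supp_Zplus ZN Z0.
  by move/esym/eqP; rewrite pnatr_eq0 => /eqP ->.
have [XkN _ XkX] := root0 _ _ _ _ _ k0 rk.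
apply/seteqP; split => // x sx.
have [j xj Xj] := supp_Zplus XN sx.
(* Using [j.+1] rather than [j] keeps the order of the root [Z] positive when [j = 0]. *)
have jk0 : (0 < j.+1 * k)%N by rewrite muln_gt0.
have [dZ [TZ [PZ [Z rZ]]]] := idX _ jk0.
have [ZN Z0 _] := root0 _ _ _ _ _ jk0 rZ.
pose f := \poly_(i < j.+1) fine (P' (Xk @^-1` [set i%:R])).
pose g := \poly_(i < j.+1) fine (PZ (Z @^-1` [set i%:R])).
have gi i : 0 <= g`_i by rewrite coef_poly; case: ifP => // _; exact: fine_ge0.
have fine0 dW (W : measurableType dW) (PW : probability W R)
    (V : {RV PW >-> R}) i : (0 < PW (V @^-1` [set i%:R]))%E =
    (0 < fine (PW (V @^-1` [set i%:R]))).
  rewrite -lte_fin fineK// fin_num_measure//; exact: measurable_funPTI.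
have g0 : 0 < g`_0 by rewrite coef_poly/= -fine0.
(* The [k]-th powers of [f] and of [g ^+ j.+1] both give the law of [X] up to degree [j]. *)
have fg : 'X^(j.+1) %| f - g ^+ j.+1.
  apply: (eq_root_mod_Xn k0).
  - by rewrite coef_poly/= fine_ge0.
  - by rewrite -horner_coef0 horner_exp horner_coef0 exprn_gt0.
  - rewrite -exprM; apply/dvdXnP => i ij; rewrite coefB; apply/eqP.
    rewrite subr_eq0; apply/eqP/EFin_inj.
    by rewrite -(pmf_nth_root XkN rk ij) -(pmf_nth_root ZN rZ ij).
rewrite xj; apply: supp_atom; rewrite fine0.
have /dvdXnP/(_ _ (ltnSn j))/eqP := fg.
rewrite coefB subr_eq0 coef_poly ltnSn => /eqP ->.
(* The probability that [X] is [j] is the coefficient of degree [j] in [g ^+ (j.+1 * k)]; its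
   positivity passes to any exponent at least [j], here [j.+1]. *)
apply: (@coefX_gt0 _ _ (j.+1 * k)) => //.
by rewrite -lte_fin -(pmf_nth_root ZN rZ (ltnSn j)).
Qed.

End roots.

Lemma supp_root_iff_DID (R : realType) d (T : measurableType d)
    (P : probability T R) (X : {RV P >-> R}) l (F_ : nat -> R -> \bar R) n :
  Zplus_valued X -> infinitely_divisible X -> is_left_extremity X l ->
  (forall k : nat, (0 < k)%N -> is_convolution_root X k (F_ k)) ->
  (2 <= n)%N ->
  (supp (F_ n) = supp (cdf X) <-> discretely_infinitely_divisible X) /\
  (discretely_infinitely_divisible X ->
    forall k : nat, (0 < k)%N -> supp (F_ k) = supp (cdf X)).
Proof.
move=> XN idX lX rF n2; have n0 := ltnW n2.
have didF : discretely_infinitely_divisible X ->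
    forall k : nat, (0 < k)%N -> supp (F_ k) = supp (cdf X).
  move/(DID_left_extremity XN idX lX) => l0 k k0.
  have [d' [T' [P' [Xk [rk ->]]]]] := rF k k0.
  by rewrite l0 in lX; exact: supp_nth_root rk.
split=> //; split=> [FX|/didF]; last exact.
apply/(DID_left_extremity XN idX lX).
have [d' [T' [P' [Xn [rn Fn]]]]] := rF n n0.
(* Now [l%:R / n%:R] lies in the support of [X], hence is at least [l]; as [n >= 2], only [l = 0]
   remains. *)
have [+ _] := nth_root_supp XN lX n0 rn; rewrite -Fn FX.
case/(supp_left_extremity XN lX) => k lk.
rewrite -(ler_nat R) -lk ler_pdivlMr ?ltr0n// -natrM ler_nat.
case: (l) => // l'; rewrite leqNgt => /negP[].
by rewrite -[ltnLHS]muln1 ltn_pmul2l.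
Qed.

(** * Nonnegative combinations and the generated semigroup *)

Section combinations.
Variables (R : realType) (m : option nat) (y : nat -> nat).
Let G : set R := [set (y i)%:R | i in index_set m].

(** Listing each generator with its multiplicity allows the terms to be matched one by one with the
    jumps of the process. *)
Lemma nonneg_combinations_seq (x : R) : nonneg_combinations m y x ->
  exists2 s : seq nat, (forall i, i \in s -> index_set m i) &
    x = \sum_(i <- s) (y i)%:R.
Proof.
move=> [n _ ->].
pose C : set R := [set x | exists2 s : seq nat,
  (forall i, i \in s -> index_set m i) & x = \sum_(i <- s) (y i)%:R].
have C0 : C 0 by exists [::] => //; rewrite big_nil.
have CD a b : C a -> C b -> C (a + b).
  move=> [s sm ->] [t tm ->]; exists (s ++ t); last by rewrite big_cat.
  by move=> i; rewrite mem_cat => /orP[/sm|/tm].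
have Cy k i : index_set m i -> C (k * y i)%:R.
  move=> mi; elim: k => [//|k IH]; rewrite mulSn natrD; apply: CD => //.
  exists [:: i]; last by rewrite big_seq1.
  by move=> j; rewrite inE => /eqP ->.
(* A sum over a set where infinitely many terms are nonzero is 0 by convention, which is also the
   sum of the empty list. *)
have [fin|inf] := pselect
    (finite_set (index_set m `&` (fun i => (n i * y i)%:R : R) @^-1` [set~ 0])).
- rewrite -/(C _) big_seq; apply: (big_ind C) => // i.
  by rewrite in_finite_support// inE => -[mi _]; exact: Cy.
- by rewrite no_finite_support// big_nil.
Qed.

Lemma nonneg_combinations0 : nonneg_combinations m y (0 : R).
Proof.
exists (fun=> 0%N).
  by rewrite (_ : [set i | _] = set0) ?setI0; [exact: finite_set0|by apply/seteqP; split].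
by rewrite fsbig1// => i _; rewrite mul0n.
Qed.

Lemma nonneg_combinationsD (a b : R) : nonneg_combinations m y a ->
  nonneg_combinations m y b -> nonneg_combinations m y (a + b).
Proof.
move=> [n1 f1 ->] [n2 f2 ->].
pose D := index_set m `&` [set i | (n1 i + n2 i)%N != 0%N].
have finD : finite_set D.
  apply: sub_finite_set (_ : finite_set ((index_set m `&` [set i | n1 i != 0%N])
    `|` (index_set m `&` [set i | n2 i != 0%N]))) => [i [mi /=]|].
    by rewrite addn_eq0 negb_and => /orP[ni|ni]; [left|right].
  by rewrite finite_setU.
exists (fun i => n1 i + n2 i)%N => //.
(* All three sums reduce to the finite set [D] of indices where [n1] or [n2] is nonzero, and can
   then be added termwise. *)
have sumD k : (forall i, n1 i + n2 i = 0 -> k i = 0)%N ->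
    \sum_(i \in index_set m) ((k i * y i)%:R : R) = \sum_(i \in D) ((k i * y i)%:R : R).
  move=> k0; apply/esym; apply: fsbig_widen => [i []//|i [mi] /=].
  move=> /not_andP[//|/negP/negPn/eqP/k0 ->].
  by rewrite mul0n.
rewrite !sumD => [||i|i] //; last 2 first.
- by move/eqP; rewrite addn_eq0 => /andP[_ /eqP].
- by move/eqP; rewrite addn_eq0 => /andP[/eqP].
by rewrite -fsbig_split//; apply: eq_fsbigr => i _; rewrite mulnDl natrD.
Qed.

Lemma nonneg_combinations1 i : index_set m i ->
  nonneg_combinations m y ((y i)%:R : R).
Proof.
move=> mi; exists (fun j => (j == i) : nat).
  apply: sub_finite_set (finite_set1 i) => j [_ /=].
  by case: (j =P i).
rewrite -(@fsbig_widen _ _ _ _ [set i]) ?fsbig_set1 ?eqxx ?mul1n//.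
  by move=> j ->.
by move=> j [_ /= /eqP/negPf ->]; rewrite mul0n.
Qed.

Lemma generated_sub_combinations :
  generated_semigroup0 G `<=` nonneg_combinations m y.
Proof.
apply: smallest_sub => [|x [i mi <-]]; last exact: nonneg_combinations1.
split; [exact: nonneg_combinations0|exact: nonneg_combinationsD].
Qed.

End combinations.

(** * Support of the compound Poisson variable *)

Section compound_poisson.
Context d (T : measurableType d) (R : realType) (P : probability T R).

(** Almost surely [N 0] is 0, so [N t] coincides with the increment from time 0 to [t], whose
    Poisson mass is positive at every [k]. *)
Lemma poisson_process_gt0 (lambda : R) (N : R -> {RV P >-> nat}) t k :
  0 < lambda -> is_poisson_process lambda N -> 0 < t ->
  (0 < P (N t @^-1` [set k]))%E.
Proof.
move=> lambda0 [N0 _ Npmf] t0.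
have mN s j : measurable (N s @^-1` [set j]) by exact: measurable_funPTI.
rewrite (_ : P _ = (poisson_pmf (lambda * t) k)%:E).
  have rate0 : 0 < lambda * t by exact: mulr_gt0.
  by rewrite lte_fin /poisson_pmf rate0 mulr_gt0 ?expR_gt0// mulr_gt0 ?exprn_gt0.
rewrite -[t in RHS]subr0 -(Npmf 0 t k (lexx 0) t0).
have mD : measurable [set w | (N t w)%:R - (N 0 w)%:R = k%:R :> R].
  rewrite (_ : [set w | _] =
      \bigcup_j (N 0 @^-1` [set j] `&` N t @^-1` [set (j + k)%N])).
    by apply: bigcupT_measurable => j; exact: measurableI.
  apply/seteqP; split => w /=; last first.
    by move=> [j _ [/= -> ->]]; rewrite natrD addrC addKr.
  move=> /eqP; rewrite subr_eq -natrD eqr_nat => /eqP Ntw.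
  by exists (N 0 w) => //; split => //=; rewrite addnC.
apply: ae_measure_eq => //.
apply: filterS N0 => w [N0w _ _] /=; rewrite N0w subr0.
by split => [->//|/eqP]; rewrite eqr_nat => /eqP.
Qed.

Variables (N : R -> {RV P >-> nat}) (Y : nat -> {RV P >-> R}).
Variables (m : option nat) (y : nat -> nat).
Let S : set R := [set (y i)%:R | i in index_set m].
Hypothesis suppY : forall i, supp (cdf (Y i)) = S.

Lemma supp_random_sum_sub t :
  supp (cdf (random_sum (N t) Y : {RV P >-> R})) `<=` generated_semigroup0 S.
Proof.
have YS : \forall w \ae P, forall i, S (Y i w).
  by apply/ae_foralln => i; rewrite -(suppY i); exact: ae_supp.
have RN : Zplus_valued (random_sum (N t) Y : {RV P >-> R}).
  apply: filterS YS => w YS; rewrite /= /random_sum.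
  apply: (big_ind (fun z : R => exists k : nat, z = k%:R)).
  - by exists 0%N.
  - by move=> _ _ [a ->] [b ->]; exists (a + b)%N; rewrite natrD.
  - by move=> i _; have [j _ <-] := YS i; exists (y j).
move=> x /(supp_Zplus RN)[k ->].
move/(measure_gt0_ae_ex (measurable_funPTI _ (measurable_set1 _)))/(_ YS).
move=> [w /= <- YSw]; rewrite /random_sum => C [[C0 CD] SC].
by apply: big_ind => // i _; exact: SC.
Qed.

Lemma combinations_sub_supp (lambda t : R) : 0 < lambda ->
  is_poisson_process lambda N ->
  mutually_independent P (fun i : nat => Y i : T -> R) ->
  independent_systems P
    (sigma_of_family [set t : R | 0 <= t] (fun t : R => N t : T -> nat))
    (sigma_of_family [set: nat] (fun i : nat => Y i : T -> R)) ->
  0 < t ->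
  nonneg_combinations m y `<=`
    supp (cdf (random_sum (N t) Y : {RV P >-> R})).
Proof.
move=> lambda0 poisN indY indNY t0 x /nonneg_combinations_seq[s sm ->].
apply: supp_atom.
pose A := N t @^-1` [set size s].
pose B := \bigcap_(i in [set` iota 0 (size s)])
  Y i @^-1` [set (y (nth 0%N s i))%:R].
have mA : measurable A by exact: measurable_funPTI.
have mB : measurable B.
  by apply: fin_bigcap_measurable => // i _; exact: measurable_funPTI.
have PB : (0 < P B)%E.
  apply: (independent_gt0 indY) => // [|i]; first exact: iota_uniq.
  rewrite mem_iota/= add0n => si.
  have : supp (cdf (Y i)) (y (nth 0%N s i))%:R.
    by rewrite suppY; exists (nth 0%N s i) => //; apply/sm/mem_nth.
  have YN : Zplus_valued (Y i).
    by apply: Zplus_supp => z; rewrite suppY => -[j _ <-]; exists (y j).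
  by move=> /(supp_Zplus YN)[k ->].
have PAB : (0 < P (A `&` B))%E.
  rewrite indNY; first by rewrite mule_gt0// (poisson_process_gt0 _ lambda0).
    apply: sub_sigma_algebra; exists t; first exact: ltW.
    by exists [set size s] => //; rewrite setTI.
  (* [B] is a finite intersection of generators of the sigma-algebra of the jumps, so closure under
     finite intersections is used in that sigma-algebra. *)
  apply: (@fin_bigcap_measurable _ (g_sigma_algebraType
    (\bigcup_(i in [set: nat]) preimage_set_system [set: T] (Y i) measurable))).
    exact: finite_seq.
  move=> i _; apply: sub_sigma_algebra; exists i => //.
  by exists [set (y (nth 0%N s i))%:R] => //; rewrite setTI.
apply: (lt_le_trans PAB); apply: le_measure; rewrite ?inE.
- exact: measurableI.
- exact: measurable_funPTI.
move=> w [/= Nw Bw]; rewrite /random_sum Nw (big_nth 0%N) big_mkord.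
apply: eq_bigr => i _; apply: (Bw i) => /=.
by rewrite mem_iota/= add0n.
Qed.

End compound_poisson.

Theorem theorem10 (R : realType) :
  (forall (d d0 : measure_display)
      (T : measurableType d) (P : probability T R)
      (T0 : measurableType d0) (P0 : probability T0 R)
      (lambda : R) (N : R -> {RV P >-> nat})
      (Y0 : {RV P0 >-> R}) (Y : nat -> {RV P >-> R})
      (m : option nat) (y : nat -> nat),
    0 < lambda ->
    is_poisson_process lambda N ->
    mutually_independent P (fun i : nat => Y i : T -> R) ->
    (forall i : nat, same_law (Y i) Y0) ->
    independent_systems P
      (sigma_of_family [set t : R | 0 <= t] (fun t : R => N t : T -> nat))
      (sigma_of_family [set: nat] (fun i : nat => Y i : T -> R)) ->
    (forall i : nat, index_set m i -> (0 < y i)%N) ->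
    supp (cdf Y0) = [set (y i)%:R | i in index_set m] ->
    forall t : R, 0 < t ->
      supp (cdf (random_sum (N t) Y : {RV P >-> R})) =
        nonneg_combinations m y /\
      supp (cdf (random_sum (N t) Y : {RV P >-> R})) =
        generated_semigroup0 [set (y i)%:R | i in index_set m])
  /\
  (forall (d : measure_display) (T : measurableType d) (P : probability T R)
      (X : {RV P >-> R}) (l : nat) (F_ : nat -> R -> \bar R),
    Zplus_valued X ->
    infinitely_divisible X ->
    is_left_extremity X l ->
    has_gcd (supp (cdf (translate X l%:R : {RV P >-> R}))) 1 ->
    (forall k : nat, (0 < k)%N -> is_convolution_root X k (F_ k)) ->
    forall n : nat, (2 <= n)%N ->
      (supp (F_ n) = supp (cdf X) <-> discretely_infinitely_divisible X) /\
      (discretely_infinitely_divisible X ->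
         forall k : nat, (0 < k)%N -> supp (F_ k) = supp (cdf X))).
Proof.
split=> [d d0 T P T0 P0 lambda N Y0 Y m y lambda0 poisN indY lawY indNY _ suppY0
    t t0|d T P X l F_ XN idX lX _ rF n n2]; last first.
  exact: (supp_root_iff_DID XN idX lX rF n2).
have suppY i : supp (cdf (Y i)) = [set (y j)%:R | j in index_set m].
  by rewrite (same_law_cdf (lawY i)).
(* The support lies in the semigroup, the semigroup in the combinations, and these in the support:
   the cycle gives both equalities. *)
have supp_gen := supp_random_sum_sub (N := N) (t := t) suppY.
have comb_supp := combinations_sub_supp suppY lambda0 poisN indY indNY t0.
have gen_comb := @generated_sub_combinations R m y.
split; apply/seteqP; split => //.
- exact: subset_trans supp_gen gen_comb.
- exact: subset_trans gen_comb comb_supp.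
Qed.
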